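(* Let $E$ and $F$ be Banach spaces. If $\overline{B_{\mathcal{K}(E,F)}}^{SOT}\neq B_{\mathcal{K}(E,F)}$, then the pair $(E,F)$ has the James property.
   Context: All Banach spaces are over a fixed field $\mathbb{K}$, which is either $\mathbb{R}$ or $\mathbb{C}$. $\mathcal{L}(E,F)$ is the space of all bounded linear operators from $E$ into $F$ with the operator norm, $\mathcal{K}(E,F)$ is its subspace of compact operators, and $B_{\mathcal{K}(E,F)}=\{T\in\mathcal{K}(E,F):\|T\|\le 1\}$. The strong operator topology (SOT) on $\mathcal{L}(E,F)$ is the topology in which a net $(T_\alpha)$ converges to $T$ if and only if $\|T_\alpha(x)-T(x)\|\to 0$ for every $x\in E$; $\overline{B_{\mathcal{K}(E,F)}}^{SOT}$ is the SOT-closure in $\mathcal{L}(E,F)$. The weak operator topology (WOT) is the topology in which $(T_\alpha)$ converges to $T$ if and only if $y^*(T_\alpha(x))\to y^*(T(x))$ for all $x\in E$ and $y^*\in F^*$. James property: a pair $(E,F)$ of Banach spaces has the James property if there exists a relatively WOT-compact set $K\subseteq\mathcal{L}(E,F)$ (i.e. the WOT-closure of $K$ in $\mathcal{L}(E,F)$ is WOT-compact) such that $0\in\overline{K}^{WOT}$ and $0\notin\overline{\operatorname{co}}^{\|\cdot\|}(K)$, where $\overline{\operatorname{co}}^{\|\cdot\|}(K)$ is the norm-closed convex hull of $K$. *)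

(* Defs.v *)
From HB Require Import structures.
From mathcomp Require Import all_boot all_order all_algebra.
From mathcomp Require Import complex.
From mathcomp Require Import all_classical all_reals all_analysis.

Set Implicit Arguments.
Unset Strict Implicit.
Unset Printing Implicit Defensive.

Import Order.TTheory GRing.Theory Num.Theory.
Import numFieldNormedType.Exports.

Local Open Scope classical_set_scope.
Local Open Scope ring_scope.

Inductive real_or_complex : numFieldType -> Prop :=
| real_field (R : realType) : real_or_complex R
| complex_field (R : realType) : real_or_complex R[i].

Section BoundedOperators.
Variables (K : numFieldType) (E F : normedModType K).

Definition bounded_linear : {pred E -> F} :=
  [pred f : E -> F |
    `[< linear f /\ exists M : K, forall x, `|f x| <= M * `|x| >]].

Lemma bounded_linear_submod_closed : submod_closed bounded_linear.
Proof.
split=> [|a f g /asboolP[fl [M fM]] /asboolP[gl [N gN]]]; apply/asboolP.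
  split=> [b x y|]; first by rewrite /= scaler0 addr0.
  by exists 0 => x; rewrite /= normr0 mul0r.
split=> [b x y|].
  change (a *: f (b *: x + y) + g (b *: x + y) =
          b *: (a *: f x + g x) + (a *: f y + g y)).
  rewrite fl gl !scalerDr !scalerA (mulrC a b) -!addrA; congr (_ + _).
  by rewrite addrCA.
exists (`|a| * M + N) => x.
change (`|a *: f x + g x| <= (`|a| * M + N) * `|x|).
rewrite (le_trans (ler_normD _ _))// mulrDl lerD// normrZ -mulrA.
by rewrite ler_wpM2l.
Qed.

HB.instance Definition _ :=
  GRing.isSubmodClosed.Build K (E -> F) bounded_linear
    bounded_linear_submod_closed.

Record bop := BOp { bop_fun :> E -> F; _ : bop_fun \in bounded_linear }.

HB.instance Definition _ := [isSub for bop_fun].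
HB.instance Definition _ := [Choice of bop by <:].
HB.instance Definition _ := [SubChoice_isSubLmodule of bop by <:].

Lemma bop_linear (T : bop) : linear T.
Proof. by case: T => f /= fP; case/asboolP: fP. Qed.

HB.instance Definition _ (T : bop) :=
  GRing.isLinear.Build K E F _ (bop_fun T) (bop_linear T).

(* The order of [K] is partial when [K] is the complex field; the supremum is
   taken for that order, and nonnegative elements are real. *)
Definition opnorm (T : bop) : K :=
  supremum 0 [set `|T x| | x in [set x : E | `|x| <= 1]].

Definition compact_operator (T : bop) : Prop :=
  precompact (T @` [set x : E | `|x| <= 1]).

Definition compact_unit_ball : set bop :=
  [set T | compact_operator T /\ opnorm T <= 1].

Definition convex_hull (A : set bop) : set bop :=
  [set T | exists (n : nat) (c : 'I_n -> K) (S : 'I_n -> bop),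
    [/\ forall i, 0 <= c i, \sum_(i < n) c i = 1, forall i, A (S i)
      & T = \sum_(i < n) c i *: S i]].

Definition norm_closure (A : set bop) : set bop :=
  [set T | forall e : K, 0 < e -> exists2 S, A S & opnorm (T - S) < e].

Definition sot : topologicalType :=
  initial_topology (bop_fun : bop -> {ptws E -> F}).

Definition sot_closure (A : set bop) : set bop := @closure sot A.

End BoundedOperators.

Arguments compact_unit_ball {K} E F.

Definition dual (K : numFieldType) (F : normedModType K) := bop F K^o.

Definition wot (K : numFieldType) (E F : normedModType K) : topologicalType :=
  initial_topology ((fun T p => p.2 (T p.1)) :
    bop E F -> {ptws E * dual F -> K^o}).

Definition wot_closure (K : numFieldType) (E F : normedModType K)
    (A : set (bop E F)) : set (bop E F) := @closure (wot E F) A.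

Definition wot_compact (K : numFieldType) (E F : normedModType K)
    (A : set (bop E F)) : Prop := @compact (wot E F) A.

Definition james_property (K : numFieldType) (E F : normedModType K) : Prop :=
  exists A : set (bop E F),
    [/\ wot_compact (wot_closure A), wot_closure A 0
      & ~ norm_closure (convex_hull A) 0].

(* Main.v *)
(** Let T be an SOT-limit of compact contractions that is not compact.

If some bounded functional phi on E^* is at distance more than d > 0 from the
evaluations at points of E, then by Helly's argument the functionals f with
|f| <= 1 and phi f = d have 0 as a weak-* cluster point, while their norm-closed
convex hull stays in the hyperplane [phi = d]; tensoring with a fixed nonzero
y in F gives a James set for (E,F).

Otherwise bounded sequences in E have weak limits along ultrafilters, and a
closing-off argument replaces the net by a sequence. One builds compact
contractions S_n and finite subsets A_n of the unit ball of E such that S_n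
approximates T on A_n, the points of the union of the A_n witness that T is not
compact, and A_{n+1} is a 1/(n+1)-net of the ball simultaneously for S_0, ...,
S_n. For x in the ball let m be a weak limit of points a_n in A_{n+1} that are
close to x in this sense: then S_n x = S_n m for all n, and S_n m tends weakly
to T m since m lies in the closed span of the A_n. Hence S_n converges in the
WOT to an operator L which agrees with T on all A_n, so that L is not compact,
and the set of all S_n - L is a James set: a convex combination of these of
small norm would approximate L by compact operators. *)

Require Import Defs.
From HB Require Import structures.
From mathcomp Require Import all_boot all_order all_algebra.
From mathcomp Require Import complex lra ring.
From mathcomp Require Import all_classical all_reals all_analysis.

Set Implicit Arguments.
Unset Strict Implicit.
Unset Printing Implicit Defensive.

Import Order.TTheory GRing.Theory Num.Theory.
Import numFieldNormedType.Exports.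

Local Open Scope classical_set_scope.
Local Open Scope ring_scope.

(** * Scalars *)

(** The complex order is partial, but a number that is at least 0 is real, so a least upper bound is
    found among the real parts. *)
Lemma supremums_nonempty (K : numFieldType) (hK : real_or_complex K)
    (A : set K) (M : K) :
  A !=set0 -> (forall x, A x -> 0 <= x <= M) -> supremums A !=set0.
Proof.
case: K / hK A M => R A M [a Aa] AM.
  have supA : has_sup A.
    by split; [exists a | exists M => x /AM /andP[]].
  exists (sup A); split; first exact: sup_upper_bound.
  by move=> b ub; apply: ge_sup => //; exists a.
have AR x : A x -> complex.Im x = 0 by case/AM/andP => /ger0_Im.
have supA : has_sup ((@complex.Re R) @` A).
  split; first by exists (complex.Re a), a.
  exists (complex.Re M) => _ [x /AM /andP[_]] /[swap] <-.
  by rewrite lecE => /andP[].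
exists (sup ((@complex.Re R) @` A))%:C%C; split.
  move=> x Ax; rewrite lecE /= AR// eqxx/=.
  by apply: sup_upper_bound => //; exists x.
move=> b ub; have := ub _ Aa; rewrite !lecE /= (AR a)// => /andP[-> _] /=.
apply: ge_sup; first by case: supA.
by move=> _ [x /ub + <-]; rewrite lecE => /andP[].
Qed.

Lemma invr_natS_lt (K : numFieldType) (hK : real_or_complex K) (e : K) :
  0 < e -> exists N, forall n, (N <= n)%N -> n.+1%:R^-1 < e.
Proof.
suff archi : 0 < e -> exists n : nat, n.+1%:R^-1 < e.
  move=> /archi[N Ne]; exists N => n Nn; apply: le_lt_trans Ne.
  by rewrite lef_pV2 ?posrE// ler_nat ltnS.
case: K / hK e => R e e0.
  exists (Num.truncn e^-1); rewrite -[X in _ < X]invrK ltf_pV2 ?posrE ?invr_gt0//.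
  by rewrite truncnS_gt.
have eR : (complex.Re e)%:C%C = e by rewrite RRe_real// gtr0_real.
move: e0; rewrite -eR ltcR => e0.
exists (Num.truncn (complex.Re e)^-1).
rewrite -(rmorph_nat (real_complex R)) -fmorphV ltcR.
rewrite -[X in _ < X]invrK ltf_pV2 ?posrE ?invr_gt0//.
by rewrite truncnS_gt.
Qed.

Lemma real_ultra_cvg (R : realType) (T : Type) (U : set_system T)
    (UU : UltraFilter U) (g : T -> R) (M : R) :
  (forall t, `|g t| <= M) ->
  exists l : R, forall e, 0 < e -> U [set t | `|l - g t| < e].
Proof.
move=> gM.
have [|l [_ lU]] := @segment_compact _ (- M) M (g @ U) _.
  by apply: (@filterE _ U) => t /=; rewrite in_itv/= -ler_norml.
exists l => e e0.
(* For an ultrafilter a cluster point is a limit: otherwise the complement of the ball would be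
   large and yet meet the ball. *)
case: (in_ultra_setVsetC [set t | `|l - g t| < e] UU) => // Ue.
have [|z []] := lU [set z | ~ `|l - z| < e] (ball l e) Ue.
  exact: nbhsx_ballx.
by [].
Qed.

Lemma real_or_complex_ultra_cvg (K : numFieldType) (hK : real_or_complex K)
    (T : Type) (U : set_system T) (UU : UltraFilter U) (g : T -> K) (M : K) :
  (forall t, `|g t| <= M) -> exists l : K^o, (g : T -> K^o) @ U --> l.
Proof.
case: K / hK g M => R g M gM.
  have [l gl] := real_ultra_cvg UU gM.
  by exists l; apply/cvgrPdist_lt.
have normM x : `|x : R[i]| <= M ->
    `|complex.Re x| <= complex.Re M /\ `|complex.Im x| <= complex.Re M.
  move=> xM; split.
    by have := le_trans (normc_ge_Re x) xM; rewrite lecE => /andP[].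
  (* The real part of [x * 'i] is minus the imaginary part of [x], so the bound on real parts serves
     again. *)
  have := normc_ge_Re (x * 'i%C); rewrite ReiNIm normrN normrM.
  rewrite [X in _ * X]normc_def/= expr0n add0r expr1n sqrtr1 mulr1.
  by move=> /le_trans /(_ xM); rewrite lecE => /andP[].
have [a ga] := real_ultra_cvg UU (fun t => (normM _ (gM t)).1).
have [b gb] := real_ultra_cvg UU (fun t => (normM _ (gM t)).2).
exists (a%:C + 'i * b%:C)%C; apply/cvgrPdist_lt => e e0.
have eR : (complex.Re e)%:C%C = e by rewrite RRe_real// gtr0_real.
move: e0; rewrite -eR ltcR => e0.
have e20 : 0 < complex.Re e / 2 by rewrite divr_gt0.
apply: filterS (filterI (ga _ e20) (gb _ e20)) => t /= [at_ bt].
rewrite [g t]complexE opprD addrACA -mulrBr -!rmorphB/=.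
rewrite (le_lt_trans (ler_normD _ _))// normrM.
have nR (x : R) : `|x%:C%C| = `|x|%:C%C.
  by rewrite normc_def/= expr0n addr0 sqrtr_sqr.
have -> : `|'i%C : R[i]| = 1.
  by rewrite normc_def/= expr0n add0r expr1n sqrtr1.
by rewrite mul1r !nR -rmorphD ltcR [ltRHS]splitr ltrD.
Qed.

(** * The Hahn-Banach theorem *)

Section RealHahnBanach.
Variables (R : realType) (V : lmodType R) (p : V -> R).
Hypothesis pD : forall u v, p (u + v) <= p u + p v.
Hypothesis pZ : forall a v, 0 <= a -> p (a *: v) = a * p v.

(** Partial functionals are encoded as linear relations; domination by [p] already forces them to be
    single-valued. *)
Let dominated (G : set (V * R^o)) :=
  (forall a u v, G u -> G v -> G (a *: u + v)) /\
  forall u, G u -> u.2 <= p u.1.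

(** Domination asks [c] to lie above every [u.2 - p (u.1 - v0)] and below every
    [p (u.1 + v0) - u.2]. Subadditivity puts the first family below the second, so the supremum of
    the first will do. *)
Let dominated_extend (G : set (V * R^o)) (v0 : V) : G 0 -> dominated G ->
  exists c : R,
    dominated [set w | exists u a, G u /\ w = u + a *: (v0, c : R^o)].
Proof.
move=> G0 [GL Gp].
pose S := [set r | exists2 u : V * R^o, G u & r = u.2 - p (u.1 - v0)].
have Sub u : G u -> ubound S (p (u.1 + v0) - u.2).
  move=> Gu _ [w Gw ->].
  have := Gp _ (GL 1 _ _ Gu Gw); rewrite scale1r /= => h.
  have := pD (u.1 + v0) (w.1 - v0).
  by rewrite addrACA subrr addr0 => h'; lra.
have supS : has_sup S.
  split; first by exists ((0 : V * R^o).2 - p ((0 : V * R^o).1 - v0)), 0.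
  by exists (p ((0 : V * R^o).1 + v0) - (0 : V * R^o).2); exact: Sub.
have Sle u : G u -> u.2 - p (u.1 - v0) <= sup S.
  by move=> Gu; apply: sup_upper_bound => //; exists u.
have Sge u : G u -> sup S <= p (u.1 + v0) - u.2.
  by move=> Gu; apply: ge_sup; [case: supS | exact: Sub].
have GZ a u : G u -> G (a *: u) by move=> Gu; rewrite -[_ *: _]addr0; exact: GL.
have sE (a b : R) : a *: (b : R^o) = a * b by [].
exists (sup S); split.
  move=> a _ _ [u [b [Gu ->]]] [w [c [Gw ->]]].
  exists (a *: u + w), (a * b + c); split; first exact: GL.
  by rewrite scalerDr scalerA addrACA -scalerDl.
move=> _ [u [a [Gu ->]]] /=; rewrite sE.
have [a0|a0|->] := ltgtP a 0; last 1 first.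
- by rewrite mul0r addr0 scale0r addr0; exact: Gp.
- have b0 : 0 < - a by rewrite oppr_gt0.
  have bn : - a != 0 by rewrite gt_eqF.
  have -> : u.1 + a *: v0 = (- a) *: ((- a)^-1 *: u.1 - v0).
    by rewrite scalerBr scalerA divff// scale1r scaleNr opprK.
  rewrite pZ ?(ltW b0)//.
  have /= := Sle _ (GZ (- a)^-1 _ Gu); rewrite sE => h.
  have := ler_wpM2l (ltW b0) h; rewrite mulrBr mulrA divff// mul1r; lra.
- have an : a != 0 by rewrite gt_eqF.
  have -> : u.1 + a *: v0 = a *: (a^-1 *: u.1 + v0).
    by rewrite scalerDr scalerA divff// scale1r.
  rewrite pZ ?(ltW a0)//.
  have /= := Sge _ (GZ a^-1 _ Gu); rewrite sE => h.
  have := ler_wpM2l (ltW a0) h; rewrite mulrBr mulrA divff// mul1r; lra.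
Qed.

(* [G] is the graph of the functional to be extended. *)
Lemma real_hahn_banach (G : set (V * R^o)) : G 0 ->
  (forall a u v, G u -> G v -> G (a *: u + v)) ->
  (forall u, G u -> u.2 <= p u.1) ->
  exists g : V -> R,
    [/\ forall a u v, g (a *: u + v) = a * g u + g v,
        forall u, G u -> g u.1 = u.2 & forall v, g v <= p v].
Proof.
move=> G0 GL Gp.
(* Zorn's lemma is applied to the sets whose union with [G] is dominated, so that the empty chain is
   covered too. *)
have [F FP Ftot|A [AP Amax]] :=
    @Zorn_bigcup _ [set A | dominated (A `|` G)].
  split=> [a u v Fu Fv|u [[X FX Xu]|/Gp//]]; last first.
    by case: (FP _ FX) => _; apply; left.
  have key X : F X -> (X `|` G) u -> (X `|` G) v ->
      (\bigcup_(Y in F) Y `|` G) (a *: u + v).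
    move=> FX Xu Xv; case: (FP _ FX) => /(_ a _ _ Xu Xv)[h|h] _; last by right.
    by left; exists X.
  case: Fu Fv => [[X FX Xu]|Gu] [[Y FY Yv]|Gv].
  - case: (Ftot _ _ FX FY) => XY.
      by apply: (key Y) => //; left => //; exact: XY.
    by apply: (key X) => //; left => //; exact: XY.
  - by apply: (key X) => //; [left | right].
  - by apply: (key Y) => //; [right | left].
  - by right; exact: GL.
set D := A `|` G in AP.
have D0 : D 0 by right.
have [DL Dp] := AP.
have Dtot v : exists r, D (v, r).
  apply: contrapT => /forallNP vD.
  have [c [BL Bp]] := dominated_extend v D0 AP.
  set B := [set w | _] in BL Bp.
  have DB : D `<=` B by move=> w Dw; exists w, 0; rewrite scale0r addr0.
  have Bv : B (v, c) by exists 0, 1; rewrite scale1r add0r.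
  have BG : B `|` G = B by apply/setUidPl => w Gw; apply: DB; right.
  apply: (Amax B); last by rewrite /= BG.
  split; first by move=> w Aw; apply: DB; left.
  by move=> /(_ _ Bv) Av; apply: (vD c); left.
have p0 : p 0 = 0 by rewrite -(scale0r 0) pZ// mul0r.
have Dle v r s : D (v, r) -> D (v, s) -> r <= s.
  move=> vr vs; have := Dp _ (DL (-1) _ _ vs vr).
  by rewrite /= !scaleN1r addNr p0 => h; rewrite -subr_le0 addrC.
have Duniq v r s : D (v, r) -> D (v, s) -> r = s.
  by move=> vr vs; apply/eqP; rewrite eq_le !(Dle v).
have [g gD] := choice Dtot; exists g; split.
- by move=> a u v; apply: Duniq (gD _) _; exact: DL a _ _ (gD u) (gD v).
- by move=> [u r] Gu; apply: Duniq (gD _) _; right.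
- by move=> v; exact: (Dp _ (gD v)).
Qed.

End RealHahnBanach.

Section Realify.
Variables (R : realType) (V : lmodType R[i]).

(** Restriction of scalars to the reals; the new name keeps the real module structure apart from the
    complex one. *)
Definition realify : Type := V.

HB.instance Definition _ := GRing.Zmodule.on realify.

Let scaleR (a : R) (v : realify) : realify := a%:C%C *: (v : V).

Let scaleRA a b v : scaleR a (scaleR b v) = scaleR (a * b) v.
Proof. by rewrite /scaleR scalerA -rmorphM. Qed.

Let scaleR1 : left_id 1 scaleR.
Proof. by move=> v; rewrite /scaleR scale1r. Qed.

Let scaleRDr : right_distributive scaleR +%R.
Proof. by move=> a u v; rewrite /scaleR scalerDr. Qed.

Let scaleRDl v : {morph scaleR^~ v : a b / a + b}.
Proof. by move=> a b; rewrite /scaleR rmorphD scalerDl. Qed.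

HB.instance Definition _ := GRing.Zmodule_isLmodule.Build R realify
  scaleRA scaleR1 scaleRDr scaleRDl.

Lemma realify_scaleE (a : R) (v : realify) : a *: v = a%:C%C *: (v : V) :> V.
Proof. by []. Qed.

End Realify.

Lemma seminorm_ge0 (K : numFieldType) (V : lmodType K) (p : V -> K) :
  (forall u v, p (u + v) <= p u + p v) ->
  (forall a v, p (a *: v) = `|a| * p v) -> forall v, 0 <= p v.
Proof.
move=> pD pZ v; have := pD v (- v).
rewrite subrr -scaleN1r pZ normrN1 mul1r -(scale0r 0) pZ normr0 mul0r.
by rewrite -mulr2n pmulrn_lge0.
Qed.

Section HahnBanach.

(** Bohnenblust-Sobczyk: the real part is extended over the reals to [h], and
    [g v = h v - i h (i v)] recovers a complex functional with real part [h]. *)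
Let complex_hahn_banach (R : realType) (V : lmodType R[i]) (p : V -> R[i])
    (G : set (V * (R[i])^o)) :
  (forall u v, p (u + v) <= p u + p v) ->
  (forall a v, p (a *: v) = `|a| * p v) ->
  G 0 -> (forall a u v, G u -> G v -> G (a *: u + v)) ->
  (forall u, G u -> `|u.2| <= p u.1) ->
  exists g : V -> R[i],
    [/\ forall a u v, g (a *: u + v) = a * g u + g v,
        forall u, G u -> g u.1 = u.2 & forall v, `|g v| <= p v].
Proof.
move=> pD pZ G0 GL Gp.
have p0 := seminorm_ge0 pD pZ.
pose W : lmodType R := realify V.
pose q (v : W) : R := complex.Re (p v).
have qE (v : W) : p v = (q v)%:C%C by rewrite RRe_real// ger0_real.
have qD (u v : W) : q (u + v) <= q u + q v.
  by rewrite -lecR rmorphD/= -!qE; exact: pD.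
have qZ a (v : W) : 0 <= a -> q (a *: v) = a * q v.
  move=> a0; apply: complexI; rewrite rmorphM/= -!qE realify_scaleE pZ.
  by rewrite ger0_norm// ler0c.
pose H : set (W * R^o) :=
  [set w | exists z : (R[i])^o, G ((w.1 : V), z) /\ w.2 = complex.Re z].
have H0 : H 0 by exists 0.
have HL a u v : H u -> H v -> H (a *: u + v).
  move=> [z [Gz uE]] [t [Gt vE]]; exists (a%:C%C *: z + t); split.
    exact: GL a%:C%C _ _ Gz Gt.
  rewrite /= uE vE raddfD /=; congr (_ + _).
  by case: (z) => x y /=; rewrite mul0r subr0.
have Hq u : H u -> u.2 <= q u.1.
  case=> z [Gz ->]; have := le_trans (normc_ge_Re z) (Gp _ Gz).
  by rewrite qE lecR; apply: le_trans; exact: ler_norm.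
have [h [hL hH hq]] := real_hahn_banach qD qZ H0 HL Hq.
have hD (u v : W) : h (u + v) = h u + h v.
  by rewrite -{1}[u]scale1r hL mul1r.
have h0 : h 0 = 0 by apply: (addrI (h 0)); rewrite -hD !addr0.
have hZ a (v : W) : h (a *: v) = a * h v.
  by rewrite -[a *: v]addr0 hL h0 addr0.
have hZR (a : R) (v : V) : h (a%:C%C *: v) = a * h v by exact: hZ.
have hiZ (a : R[i]) (v : V) :
    h (a *: v) = complex.Re a * h v + complex.Im a * h ('i%C *: v).
  rewrite {1}[a]complexE scalerDl mulrC -scalerA.
  by rewrite hD !hZR.
pose g (v : V) : R[i] := (h v -i* h ('i%C *: v))%C.
have gZ a (v : V) : g (a *: v) = a * g v.
  rewrite /g scalerA (hiZ a) (hiZ ('i%C * a)) ['i%C * a]mulrC ReiNIm ImiRe.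
  by case: a => x y /=; simpc; congr Complex; ring.
have gD (u v : V) : g (u + v) = g u + g v.
  by rewrite /g scalerDr !hD opprD.
exists g; split.
- by move=> a u v; rewrite gD gZ.
- move=> [v z] Gz /=; rewrite /g.
  have -> : h v = complex.Re z by apply: (hH (v, _)); exists z.
  have -> : h ('i%C *: v) = complex.Re ('i%C * z).
    apply: (hH ('i%C *: v : W, _)); exists ('i%C * z); split => //=.
    by have := GL 'i%C _ _ Gz G0; rewrite addr0.
  by rewrite mulrC ReiNIm opprK; case: (z).
- move=> v; have [->|gv0] := eqVneq (g v) 0; first by rewrite normr0.
  (* This unimodular factor makes [g (a *: v)] real and nonnegative, hence equal to [h (a *: v)],
     which [p] dominates. *)
  pose a := (g v)^-1 * `|g v|.
  have na : `|a| = 1.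
    by rewrite /a normrM normfV normr_id mulVf// normr_eq0.
  have : g (a *: v) = `|g v| by rewrite gZ /a mulrAC mulVf// mul1r.
  move=> /(congr1 (@complex.Re R)); rewrite [LHS]/= => ha.
  rewrite -[p v]mul1r -na -pZ qE -(RRe_real (normr_real (g v))) -ha lecR.
  exact: hq.
Qed.

Lemma hahn_banach (K : numFieldType) (hK : real_or_complex K)
    (V : lmodType K) (p : V -> K) (G : set (V * K^o)) :
  (forall u v, p (u + v) <= p u + p v) ->
  (forall a v, p (a *: v) = `|a| * p v) ->
  G 0 -> (forall a u v, G u -> G v -> G (a *: u + v)) ->
  (forall u, G u -> `|u.2| <= p u.1) ->
  exists g : V -> K,
    [/\ forall a u v, g (a *: u + v) = a * g u + g v,
        forall u, G u -> g u.1 = u.2 & forall v, `|g v| <= p v].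
Proof.
case: K / hK V p G => R V p G pD pZ G0 GL Gp; last exact: complex_hahn_banach.
have pZ' a v : 0 <= a -> p (a *: v) = a * p v.
  by move=> a0; rewrite pZ ger0_norm.
have [u Gu|g [gL gG gp]] := real_hahn_banach pD pZ' G0 GL _.
  exact: le_trans (ler_norm _) (Gp _ Gu).
exists g; split=> // v; rewrite ler_norml gp andbT lerNl.
have g0 : g 0 = 0.
  by apply: (addrI (g 0)); rewrite -[X in X + g 0]mul1r -gL scaler0 !addr0.
have := gL (-1) v 0; rewrite g0 !addr0 mulN1r => <-.
by apply: le_trans (gp _) _; rewrite pZ normrN1 mul1r.
Qed.

End HahnBanach.

(** * Operator norm, duality and operator topologies *)

Section BoundedOperatorTheory.
Variables (K : numFieldType) (E F : normedModType K).
Implicit Types (S T : bop E F) (x y : E).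

Lemma bopD S T x : (S + T) x = S x + T x. Proof. by []. Qed.
Lemma bopB S T x : (S - T) x = S x - T x. Proof. by []. Qed.
Lemma bopZ a T x : (a *: T) x = a *: T x. Proof. by []. Qed.
Lemma bop0 x : (0 : bop E F) x = 0. Proof. by []. Qed.
Lemma bop_sum n (T : 'I_n -> bop E F) x : (\sum_i T i) x = \sum_i T i x.
Proof.
by elim/big_rec2 : _ => // i v S _ <-; rewrite bopD.
Qed.

Lemma bop_ext S T : S =1 T -> S = T.
Proof. by move=> ST; apply: val_inj; apply/funext. Qed.

Lemma bop_exists (f : E -> F) (M : K) :
  (forall a x y, f (a *: x + y) = a *: f x + f y) ->
  (forall x, `|f x| <= M * `|x|) -> exists T : bop E F, T =1 f.
Proof.
move=> fL fM; have fP : f \in @bounded_linear K E F.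
  by apply/asboolP; split; [exact: fL | exists M].
by exists (BOp fP).
Qed.

Lemma bop_bounded T : exists2 M : K, 0 <= M & forall x, `|T x| <= M * `|x|.
Proof.
have : (T : E -> F) \in @bounded_linear K E F by case: T.
move=> /asboolP[_ [M TM]].
(* On the zero space the given [M] may be negative, and 0 replaces it. *)
have [[x x0]|x0] := pselect (exists x : E, x != 0).
  exists M => //; rewrite -(@pmulr_lge0 _ `|x|) ?normr_gt0//.
  exact: le_trans (TM x).
exists 0 => // x; have -> : x = 0.
  by apply: contra_notP x0 => /eqP ?; exists x.
by rewrite linear0 !normr0 mulr0.
Qed.

Section OperatorNorm.
Hypothesis hK : real_or_complex K.

(** [supremum] falls back on a default value when there is no least upper bound; boundedness of [T]
    rules this out. *)
Let opnorm_supremums T :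
  supremums [set `|T x| | x in [set x : E | `|x| <= 1]] (opnorm T).
Proof.
have [M M0 TM] := bop_bounded T.
set A := [set `|T x| | x in _].
have A0 : A !=set0 by exists `|T 0|, 0 => //=; rewrite normr0.
have [|s As] := supremums_nonempty hK (M := M) A0.
  move=> _ [x /= x1 <-]; rewrite normr_ge0/= (le_trans (TM x))//.
  by rewrite ler_piMr.
rewrite /opnorm /supremum -/A ifF; last by apply/negbTE/set0P.
by case: xgetP => [y -> //|/(_ s)].
Qed.

Lemma ler_opnorm T x : `|T x| <= opnorm T * `|x|.
Proof.
have [->|x0] := eqVneq x 0; first by rewrite linear0 !normr0 mulr0.
have nx0 : 0 < `|x| by rewrite normr_gt0.
rewrite -ler_pdivrMr//; have [ub _] := opnorm_supremums T; apply: ub.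
exists (`|x|^-1 *: x) => /=; rewrite ?linearZ/= normrZ normfV normr_id.
  by rewrite mulVf// gt_eqF.
by rewrite mulrC.
Qed.

Lemma opnorm_ge0 T : 0 <= opnorm T.
Proof.
by have [ub _] := opnorm_supremums T; apply: ub; exists 0;
  rewrite /= ?linear0 normr0.
Qed.

Lemma opnorm_le T (M : K) : 0 <= M ->
  (forall x, `|T x| <= M * `|x|) -> opnorm T <= M.
Proof.
move=> M0 TM; have [_ lub] := opnorm_supremums T; apply: lub.
by move=> _ [x /= x1 <-]; rewrite (le_trans (TM x))// ler_piMr.
Qed.

Lemma opnorm_le1P T : opnorm T <= 1 <-> forall x, `|T x| <= `|x|.
Proof.
split=> [T1 x|T1]; last by apply: opnorm_le => // x; rewrite mul1r.
by rewrite (le_trans (ler_opnorm T x))// ler_piMl.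
Qed.

Lemma opnormD S T : opnorm (S + T) <= opnorm S + opnorm T.
Proof.
apply: opnorm_le => [|x]; first by rewrite addr_ge0// opnorm_ge0.
by rewrite bopD (le_trans (ler_normD _ _))// mulrDl lerD// ler_opnorm.
Qed.

Lemma opnormZ a T : opnorm (a *: T) = `|a| * opnorm T.
Proof.
have le b (S : bop E F) : opnorm (b *: S) <= `|b| * opnorm S.
  apply: opnorm_le => [|x]; first by rewrite mulr_ge0// opnorm_ge0.
  by rewrite bopZ normrZ -mulrA ler_wpM2l// ler_opnorm.
apply/eqP; rewrite eq_le le/=; have [->|a0] := eqVneq a 0.
  by rewrite normr0 mul0r opnorm_ge0.
rewrite -ler_pdivlMl ?normr_gt0// -normfV.
by rewrite -{1}[T]scale1r -(mulVf a0) -scalerA le.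
Qed.

End OperatorNorm.

End BoundedOperatorTheory.

Section Duality.
Variables (K : numFieldType) (hK : real_or_complex K).

(** Hahn-Banach extends [a *: x |-> a * |x|] from the line through [x]. *)
Lemma norming_functional (E : normedModType K) (x : E) :
  exists f : dual E, (forall y, `|f y| <= `|y|) /\ f x = `|x|.
Proof.
pose G : set (E * K^o) := [set u | exists a, u = (a *: x, a * `|x| : K^o)].
have [|a u v [b ->] [c ->]|_ [a ->]/=|g [gL gG gp]] :=
    @hahn_banach K hK E (fun y => `|y|) G (@ler_normD _ _) (@normrZ _ _).
- by exists 0; rewrite scale0r mul0r.
- exists (a * b + c); congr pair => /=; first by rewrite scalerA scalerDl.
  by rewrite mulrDl -mulrA.
- by rewrite normrM normr_id normrZ.
have [|f fE] := @bop_exists K E K^o g 1 gL; first by move=> y; rewrite mul1r.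
exists f; split=> [y|]; rewrite fE//.
by apply: (gG (x, `|x| : K^o)); exists 1; rewrite scale1r mul1r.
Qed.

Lemma dual_separates (E : normedModType K) (x y : E) :
  (forall f : dual E, f x = f y) -> x = y.
Proof.
move=> xy; apply/eqP; rewrite -subr_eq0 -normr_eq0.
have [f [_ <-]] := norming_functional (x - y).
have -> : f (x - y) = f x - f y by exact: linearB.
by rewrite (xy f) subrr.
Qed.

End Duality.

(** * Convergence in the weak and strong operator topologies *)

Lemma initial_cvg (S : choiceType) (T : topologicalType) (f : S -> T)
    (F : set_system S) (s : S) : Filter F ->
  f @ F --> f s -> F --> (s : initial_topology f).
Proof.
move=> FF fF A [_ [[B oB <-] Bs BA]].
by apply: filterS BA _; apply: fF; exact: open_nbhs_nbhs.
Qed.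

Lemma ptws_cvgP (U : eqType) (V : topologicalType) (G : set_system (U -> V))
    (f : {ptws U -> V}) : Filter G ->
  G --> f <-> forall t, (fun g : U -> V => g t) @ G --> f t.
Proof.
move=> FG; split=> [Gf t|Gf].
  by move=> A /(@proj_continuous _ (fun=> V) t f) /Gf.
by apply/cvg_sup => t; apply: initial_cvg; exact: Gf.
Qed.

Section Topologies.
Variables (K : numFieldType) (E F : normedModType K).

Lemma wot_cvgP (G : set_system (bop E F)) (S : bop E F) : Filter G ->
  G --> (S : wot E F) <->
  forall x (g : dual F), (fun T : bop E F => g (T x)) @ G --> g (S x).
Proof.
move=> FG; split=> [GS x g|GS].
  pose ev (T : bop E F) : {ptws E * dual F -> K^o} := fun p => p.2 (T p.1).
  have : ev @ G --> ev S.
    by apply: cvg_trans (@initial_continuous _ _ ev S); exact: cvg_fmap2.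
  by move=> /ptws_cvgP/(_ (x, g)).
apply: initial_cvg; apply/ptws_cvgP => -[x g]; exact: GS.
Qed.

Lemma sot_cvgP (G : set_system (bop E F)) (S : bop E F) : Filter G ->
  G --> (S : sot E F) <->
  forall x, (fun T : bop E F => T x) @ G --> S x.
Proof.
move=> FG; split=> [GS x|GS].
  have : (@bop_fun K E F : _ -> {ptws E -> F}) @ G --> (S : {ptws E -> F}).
    pose ev : bop E F -> {ptws E -> F} := @bop_fun K E F.
    apply: cvg_trans (@initial_continuous _ _ ev S).
    exact: cvg_fmap2.
  by move=> /ptws_cvgP/(_ x).
by apply: initial_cvg; apply/ptws_cvgP => x; exact: GS.
Qed.

Lemma wot_hausdorff : real_or_complex K -> hausdorff_space (wot E F).
Proof.
move=> hK S T ST; apply: bop_ext => x; apply: dual_separates => // g.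
apply: (@norm_hausdorff _ K^o) => A B SA TB.
have cts (U : wot E F) : (fun T : bop E F => g (T x)) @ (nbhs U) --> g (U x).
  by have /wot_cvgP := @cvg_id _ (nbhs U); apply.
by have [U [AU BU]] := ST _ _ (cts S _ SA) (cts T _ TB); exists (g (U x)).
Qed.

(** Closeness to [T] at finitely many vectors defines an SOT-neighbourhood of [T], which must meet
    [A]. *)
Lemma sot_closure_approx (A : set (bop E F)) T (s : seq E) (e : K) :
  sot_closure A T -> 0 < e ->
  exists2 S, A S & forall x, x \in s -> `|T x - S x| < e.
Proof.
move=> AT e0.
have /sot_cvgP cts := @cvg_id _ (nbhs (T : sot E F)).
have : nbhs (T : sot E F)
    [set S : bop E F | forall x, x \in s -> `|T x - S x| < e].
  elim: s => [|x s IH]; first exact: filterE.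
  have xT : nbhs (T : sot E F) [set S : bop E F | `|T x - S x| < e].
    by have /cvgrPdist_lt/(_ _ e0) := cts x.
  apply: filterS (filterI xT IH) => S /= [xS sS] y.
  by rewrite inE => /predU1P[->//|/sS].
by move=> /AT[S [AS ST]]; exists S.
Qed.

End Topologies.

(** * Total boundedness and compact operators *)

(** Total boundedness, with centres allowed outside [A]. *)
Definition has_finite_nets (K : numFieldType) (F : normedModType K)
    (A : set F) : Prop :=
  forall e : K, 0 < e ->
    exists s : seq F, forall x, A x -> exists2 y, y \in s & `|x - y| < e.

Lemma precompact_finite_nets (K : numFieldType) (F : normedModType K)
    (A : set F) : precompact A -> has_finite_nets A.
Proof.
rewrite precompactE compact_cover => cA e e0.
have [i _|x _|D _ AD] := cA F setT (fun y => ball y e).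
- exact: ball_open.
- by exists x => //; exact: ballxx.
exists (finmap.enum_fset D) => x Ax.
have [y yD] := AD x (subset_closure Ax).
by rewrite -ball_normE/= distrC; exists y.
Qed.

Lemma ultra_has_seq (I : eqType) (T : Type) (U : set_system T)
    (UU : UltraFilter U) (s : seq I) (B : I -> set T) :
  U [set t | exists2 i, i \in s & B i t] -> exists2 i, i \in s & U (B i).
Proof.
elim: s => [|i s IH] Us; first by have [t []] := filter_ex Us.
have [Ui|Ui] := in_ultra_setVsetC (B i) UU; first by exists i; rewrite ?mem_head.
have [|j js Uj] := IH; last by exists j => //; rewrite inE js orbT.
apply: filterS (filterI Us Ui) => t [[j]].
by rewrite inE => /predU1P[->//|js Bj _]; exists j.
Qed.

(** By completeness it is enough that an ultrafilter containing the closure of [A] is Cauchy: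
    finitely many balls of radius [e] cover that closure, and one of them is large. *)
Lemma finite_nets_precompact (K : numFieldType) (F : completeNormedModType K)
    (A : set F) : has_finite_nets A -> precompact A.
Proof.
move=> nets; rewrite precompactE compact_ultra => U UU UA.
have /cauchy_cvg : cauchy U.
  apply: cauchy_exP => e e0.
  have e20 : 0 < e / 2 by rewrite divr_gt0.
  have [s sA] := nets _ e20.
  have [|y _ Uy] := @ultra_has_seq _ _ U UU s (fun y => ball y e);
    last by exists y.
  apply: filterS UA => x /(_ _ (nbhsx_ballx x _ e20))[z [Az]].
  rewrite -ball_normE/= => xz; have [y ys zy] := sA _ Az; exists y => //.
  rewrite distrC -(subrK z x) -addrA (le_lt_trans (ler_normD _ _))//.
  by rewrite [ltRHS]splitr ltrD.
move=> /cvg_ex[p Up]; exists p; split=> //.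
apply: closed_closure => B pB.
exact: filter_ex (filterI UA (Up _ pB)).
Qed.

Section CompactOperators.
Variables (K : numFieldType) (E F : normedModType K).
Implicit Types S T : bop E F.

Definition image_finite_nets T :=
  has_finite_nets (T @` [set x : E | `|x| <= 1]).

Lemma image_finite_nets0 : image_finite_nets 0.
Proof.
move=> e e0; exists [:: 0] => _ [x _ <-].
by exists 0; rewrite ?inE// bop0 subr0 normr0.
Qed.

Lemma image_finite_netsD S T :
  image_finite_nets S -> image_finite_nets T -> image_finite_nets (S + T).
Proof.
move=> fS fT e e0; have e20 : 0 < e / 2 by rewrite divr_gt0.
have [s Ss] := fS _ e20; have [t Tt] := fT _ e20.
exists [seq a + b | a <- s, b <- t] => _ [x x1 <-].
have [a as_ xa] := Ss (S x) (imageP _ x1).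
have [b bt xb] := Tt (T x) (imageP _ x1).
exists (a + b); first by apply/allpairsP; exists (a, b).
by rewrite bopD opprD addrACA (le_lt_trans (ler_normD _ _))// [ltRHS]splitr ltrD.
Qed.

Lemma image_finite_netsZ a T : image_finite_nets T -> image_finite_nets (a *: T).
Proof.
have [->|a0] := eqVneq a 0; first by rewrite scale0r => _; exact: image_finite_nets0.
have na : 0 < `|a| by rewrite normr_gt0.
move=> fT e e0; have [s Ts] := fT (e / `|a|) (divr_gt0 e0 na).
exists [seq a *: y | y <- s] => _ [x x1 <-].
have [y ys xy] := Ts (T x) (imageP _ x1).
exists (a *: y); first exact: map_f.
by rewrite bopZ -scalerBr normrZ mulrC -ltr_pdivlMr.
Qed.

Lemma image_finite_nets_sum n (c : 'I_n -> K) (T : 'I_n -> bop E F) :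
  (forall i, image_finite_nets (T i)) -> image_finite_nets (\sum_i c i *: T i).
Proof.
move=> fT; elim/big_ind : _ => [|S S'|i _].
- exact: image_finite_nets0.
- exact: image_finite_netsD.
- exact: image_finite_netsZ.
Qed.

Lemma image_finite_nets_approx T :
  (forall e, 0 < e -> exists2 S, image_finite_nets S &
     forall x, `|x| <= 1 -> `|T x - S x| < e) -> image_finite_nets T.
Proof.
move=> appr e e0; have e20 : 0 < e / 2 by rewrite divr_gt0.
have [S fS TS] := appr _ e20; have [s Ss] := fS _ e20.
exists s => _ [x x1 <-]; have [y ys xy] := Ss (S x) (imageP _ x1).
exists y => //; rewrite -(subrK (S x) (T x)) -addrA.
by rewrite (le_lt_trans (ler_normD _ _))// [ltRHS]splitr ltrD// TS.
Qed.

(** Induction on the list: the net of [T] cuts the ball into finitely many pieces on which [T] is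
    nearly constant, and each piece gets its own net for the other operators. The claim is made for
    every subset [B] of the ball, with net points in [B], so that it applies to the pieces. *)
Lemma common_net (Ts : seq (bop E F)) (e : K) : 0 < e ->
  (forall T, T \in Ts -> image_finite_nets T) ->
  exists s : seq E, (forall a, a \in s -> `|a| <= 1) /\
    forall x, `|x| <= 1 -> exists2 a, a \in s &
      forall T, T \in Ts -> `|T x - T a| < e.
Proof.
move=> e0 fTs; have e20 : 0 < e / 2 by rewrite divr_gt0.
suff net (B : set E) : B `<=` [set x | `|x| <= 1] ->
    exists s : seq E, (forall a, a \in s -> B a) /\
    forall x, B x -> exists2 a, a \in s & forall T, T \in Ts -> `|T x - T a| < e.
  exact: net.
elim: Ts fTs B => [_|T Ts IH fTs] B B1.
  have [[b Bb]|B0] := pselect (B !=set0).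
    exists [:: b]; split=> [a|x Bx]; first by rewrite inE => /eqP ->.
    by exists b; rewrite ?inE.
  by exists [::]; split=> // x Bx; case: B0; exists x.
have [t Tt] := fTs T (mem_head _ _) _ e20.
have /choice[s sP] y : exists s : seq E,
    (forall a, a \in s -> B a /\ `|T a - y| < e / 2) /\
    forall x, B x /\ `|T x - y| < e / 2 -> exists2 a, a \in s &
      forall S, S \in Ts -> `|S x - S a| < e.
  have [||s sP] := IH _ [set x | B x /\ `|T x - y| < e / 2]; last by exists s.
    by move=> S STs; apply: fTs; rewrite inE STs orbT.
  by move=> x [/B1].
exists (flatten [seq s y | y <- t]); split=> [a|x Bx].
  by move=> /flattenP[_ /mapP[y _ ->]] /(proj1 (sP y)) [].
have [y yt xy] := Tt (T x) (imageP _ (B1 _ Bx)).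
have [a as_ xa] := (sP y).2 x (conj Bx xy).
exists a; first by apply/flattenP; exists (s y) => //; exact: map_f.
move=> S; rewrite inE => /predU1P[->|/xa//].
have [_ ay] := (sP y).1 a as_.
rewrite -(subrK y (T x)) -addrA (le_lt_trans (ler_normD _ _))//.
by rewrite [ltRHS]splitr ltrD// distrC.
Qed.

End CompactOperators.

Lemma compact_operatorP (K : numFieldType) (E : normedModType K)
    (F : completeNormedModType K) (T : bop E F) :
  compact_operator T <-> image_finite_nets T.
Proof.
by split=> [/precompact_finite_nets//|/finite_nets_precompact].
Qed.

(** * Functionals on the dual and James sets *)

Lemma cvg_norm_le (K : numFieldType) (V : normedModType K) (I : Type)
    (G : set_system I) (PG : ProperFilter G) (h : I -> V) (l : V) (M : K) :
  h @ G --> l -> (forall i, `|h i| <= M) -> `|l| <= M.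
Proof.
move=> hl hM.
(* Over the complex field negating an inequality needs real numbers; [M] is one, since it bounds a
   norm. *)
have M_real : M \is Num.real.
  have [i _] := filter_ex (@filterT _ G _).
  by rewrite ger0_real// (le_trans _ (hM i)).
rewrite real_leNgt ?normr_real//; apply/negP => lM.
have e0 : 0 < `|l| - M by rewrite subr_gt0.
have /cvgrPdist_lt/(_ _ e0) near_h := hl.
have [j] := filter_ex near_h.
apply/negP; rewrite -real_leNgt ?normr_real ?(gtr0_real e0)//.
by rewrite (le_trans _ (lerB_dist _ _))// lerB.
Qed.

(** A form of Banach-Alaoglu: pointwise limits along the ultrafilter exist by boundedness and
    inherit linearity and the bound. *)
Lemma ultra_cvg_linear (K : numFieldType) (hK : real_or_complex K)
    (V : lmodType K) (I : Type) (U : set_system I) (UU : UltraFilter U)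
    (h : I -> V -> K^o) (p : V -> K) :
  (forall i a u v, h i (a *: u + v) = a * h i u + h i v) ->
  (forall i v, `|h i v| <= p v) ->
  exists l : V -> K^o,
    [/\ forall v, h^~ v @ U --> l v,
        forall a u v, l (a *: u + v) = a * l u + l v
      & forall v, `|l v| <= p v].
Proof.
move=> hL hp.
have /choice[l hl] v : exists l : K^o, h^~ v @ U --> l.
  exact: (real_or_complex_ultra_cvg hK (g := h^~ v) UU (hp^~ v)).
exists l; split=> // [a u v|v].
  have : h^~ (a *: u + v) @ U --> a *: l u + l v.
    under eq_fun do rewrite hL.
    by apply: cvgD (hl v); apply: cvgZr.
  by move/(cvg_unique _ (hl _)); apply.
exact: cvg_norm_le (hl v) (hp^~ v).
Qed.

Section RankOne.
Variables (K : numFieldType) (E F : normedModType K).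

Let rank_one_exists (f : dual E) (y : F) :
  exists T : bop E F, T =1 fun x => f x *: y.
Proof.
have [M M0 fM] := bop_bounded f.
apply: (@bop_exists _ _ _ _ (M * `|y|)) => [a u v|x].
  by rewrite linearP scalerDl scalerA.
by rewrite normrZ mulrAC ler_wpM2r.
Qed.

Definition rank_one (f : dual E) (y : F) : bop E F :=
  sval (cid (rank_one_exists f y)).

Lemma rank_oneE f y x : rank_one f y x = f x *: y.
Proof. exact: (svalP (cid (rank_one_exists f y))). Qed.

Lemma rank_oneP a f g y :
  rank_one (a *: f + g) y = a *: rank_one f y + rank_one g y.
Proof.
apply: bop_ext => x.
by rewrite bopD bopZ !rank_oneE scalerA -scalerDl.
Qed.

Lemma rank_one_ball_wot_compact (hK : real_or_complex K) (y : F) :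
  wot_compact [set rank_one f y | f in
    [set f : dual E | forall x, `|f x| <= `|x|]].
Proof.
set C := [set rank_one f y | f in _].
rewrite /wot_compact compact_ultra => U UU UC.
(* Every operator is given a functional, 0 if it is off [C], so that the limit along [U] can be
   taken over functionals. *)
have /choice[h hP] (T : bop E F) : exists f : dual E,
    (forall x, `|f x| <= `|x|) /\ (C T -> T = rank_one f y).
  have [[f f1 <-]|CT] := pselect (C T); first by exists f.
  by exists 0; split=> // x; rewrite bop0 normr0.
have [l [hl lL l1]] := @ultra_cvg_linear K hK E _ U UU (fun T x => h T x)
  (fun x => `|x|) (fun T => linearP (h T)) (fun T => (hP T).1).
have [|f fE] := @bop_exists K E K^o l 1 lL; first by move=> x; rewrite mul1r.
exists (rank_one f y); split.
  by exists f => // x; rewrite fE.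
apply/wot_cvgP => x g; rewrite rank_oneE fE linearZ/=.
have : (fun T : bop E F => h T x *: g y) @ U --> l x *: g y.
  by apply: cvgZl; exact: hl.
apply: cvg_trans; apply: near_eq_cvg.
apply: filterS UC => T CT /=.
by rewrite {2}((hP T).2 CT) rank_oneE linearZ.
Qed.

End RankOne.

(** Induction on [s]: subtracting from [phi] a multiple of the evaluation at [x] leaves a functional
    that vanishes on the annihilator of the shorter list. *)
Lemma functional_of_annihilator (K : numFieldType) (E : normedModType K)
    (phi : dual E -> K^o) (s : seq E) :
  (forall a f g, phi (a *: f + g) = a * phi f + phi g) ->
  (forall f : dual E, (forall x, x \in s -> f x = 0) -> phi f = 0) ->
  exists m, forall f, phi f = f m.
Proof.
elim: s phi => [|x s IH] phi phiL phi0.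
  by exists 0 => f; rewrite linear0 phi0.
have [[f0 [f0s f0x]]|nf0] := pselect (exists f0 : dual E,
    (forall z, z \in s -> f0 z = 0) /\ f0 x != 0); last first.
  apply: IH => // f fs; apply: phi0 => z; rewrite inE => /predU1P[->|/fs//].
  by apply: contra_notP nf0 => /eqP fx; exists f.
pose c : K := phi f0 / f0 x.
have [|f fs|m mP] := IH (fun f => phi f - c * f x).
- by move=> a f g; rewrite phiL bopD bopZ /= /GRing.scale/=; ring.
- have := phi0 (- (f x / f0 x) *: f0 + f) _.
  rewrite phiL /c => <- => [|z]; first by ring.
  rewrite bopD bopZ inE => /predU1P[->|zs].
    by rewrite /GRing.scale/= mulNr divfK// addNr.
  have {}fs : f z = 0 := fs z zs; have {}f0s : f0 z = 0 := f0s z zs.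
  by rewrite [X in _ *: X + _]f0s [X in _ + X]fs scaler0 addr0.
exists (m + c *: x) => f.
by rewrite linearD linearZ/= -mP /GRing.scale/= subrK.
Qed.

Section FarFunctional.
Variables (K : numFieldType) (hK : real_or_complex K) (E : normedModType K).
Variable phi : dual E -> K^o.
Hypothesis phiL : forall a f g, phi (a *: f + g) = a * phi f + phi g.
Hypothesis phiB : forall f, `|phi f| <= opnorm f.

Let phi0 : phi 0 = 0.
Proof. by have := phiL (-1) 0 0; rewrite scaler0 addr0 mulN1r addNr. Qed.

Lemma helly_annihilator (d : K) (s : seq E) : 0 < d ->
  (forall m : E, exists2 f : dual E,
     (forall x, `|f x| <= `|x|) & d < `|phi f - f m|) ->
  exists f : dual E, [/\ forall x, `|f x| <= `|x|,
    forall x, x \in s -> f x = 0 & phi f = d].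
Proof.
move=> d0 far; apply: contrapT => nf.
(* [phi] is then bounded by [d] on the annihilator [Z] of [s]; subtracting from
   it a Hahn-Banach extension of its restriction to [Z] leaves an evaluation. *)
pose Z := [set f : dual E | forall x, x \in s -> f x = 0].
have phiZ a f : phi (a *: f) = a * phi f.
  by rewrite -[a *: f]addr0 phiL phi0 addr0.
have small f : Z f -> `|phi f| <= d * opnorm f.
  move=> Zf; have rd : d * opnorm f \is Num.real.
    by rewrite ger0_real// mulr_ge0 ?opnorm_ge0// ltW.
  rewrite real_leNgt ?normr_real//; apply/negP => fd.
  have nf0 : 0 < `|phi f|.
    by rewrite (le_lt_trans _ fd)// mulr_ge0 ?opnorm_ge0// ltW.
  have pf0 : phi f != 0 by rewrite -normr_gt0.
  (* [phi f] exceeds in size [d] times the norm of [f], so this multiple stays in the unit ball of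
     the dual, and [phi] is [d] there. *)
  apply: nf; exists ((d / phi f) *: f); split=> [x|x xs|].
  - rewrite bopZ normrZ normrM normfV (gtr0_norm d0) mulrAC ler_pdivrMr//.
    apply: le_trans (ler_wpM2l (ltW d0) (ler_opnorm hK f x)) _.
    by rewrite mulrA mulrC ler_wpM2l// ltW.
  - by rewrite bopZ [X in _ *: X](Zf x xs) scaler0.
  - by rewrite phiZ divfK.
pose G : set (dual E * K^o) := [set u | Z u.1 /\ u.2 = phi u.1].
have [u v|a u||a u v [Zu uE] [Zv vE]|u [Zu ->]|psi [psiL psiG psid]] :=
    @hahn_banach K hK (dual E) (fun f => d * opnorm f) G.
- by rewrite -mulrDr ler_wpM2l ?opnormD// ltW.
- by rewrite opnormZ// mulrCA.
- by split=> //; rewrite phi0.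
- split=> [x xs|]; last by rewrite /= phiL uE vE.
  by rewrite bopD bopZ [X in _ *: X + _](Zu x xs) [X in _ + X](Zv x xs) scaler0 addr0.
- exact: small.
have [|f Zf|m mP] := @functional_of_annihilator K E (fun f => phi f - psi f) s.
- by move=> a f g; rewrite phiL psiL; ring.
- by rewrite (psiG (f, phi f)) ?subrr.
(* [phi f - f m] is [psi f], of size at most [d] on the unit ball, against [far]. *)
have [f f1] := far m; rewrite -mP opprB addrC subrK.
apply/negP; rewrite -real_leNgt ?normr_real ?gtr0_real//.
apply: le_trans (psid f) _; rewrite -[leRHS]mulr1 ler_wpM2l ?(ltW d0)//.
exact/opnorm_le1P.
Qed.

(** The James set consists of the operators [rank_one f y] with [f] in the unit ball of the dual and
    [phi f = d]. *)
Lemma james_property_far_functional (F : normedModType K) (y : F) (d : K) :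
  y != 0 -> 0 < d ->
  (forall m : E, exists2 f : dual E,
     (forall x, `|f x| <= `|x|) & d < `|phi f - f m|) ->
  james_property E F.
Proof.
move=> y0 d0 far.
pose A : set (bop E F) := [set rank_one f y | f in
  [set f : dual E | (forall x, `|f x| <= `|x|) /\ phi f = d]].
have ny : 0 < `|y| by rewrite normr_gt0.
exists A; split.
- have cB := @rank_one_ball_wot_compact K E F hK y.
  apply: (subclosed_compact _ cB); first exact: closed_closure.
  have clB := compact_closed (wot_hausdorff hK) cB.
  move=> T AT; apply: clB; apply: closureS AT.
  by move=> _ [f [f1 _] <-]; exists f.
- have /choice[f fP] s := helly_annihilator s d0 far.
  (* Indexed by finite lists under inclusion, the functionals [f s] are eventually 0 at each
     vector. *)
  pose G := filter_from [set: seq E] (fun s => [set t : seq E | {subset s <= t}]).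
  have PG : ProperFilter G.
    apply: filter_from_proper; last by move=> s _; exists s => /=.
    apply: filter_from_filter; first by exists [::].
    move=> s t _ _; exists (s ++ t) => // u /= stu.
    by split=> x xs; apply: stu; rewrite mem_cat xs ?orbT.
  have u0 : (fun s => rank_one (f s) y) @ G --> (0 : wot E F).
    apply/(@wot_cvgP _ _ _ _ (0 : bop E F)) => x g; rewrite bop0 linear0.
    apply: cvg_near_cst; exists [:: x] => // s /= xs; have [_ fs _] := fP s.
    have {}fs : f s x = 0 by apply/fs/xs; rewrite mem_head.
    by rewrite rank_oneE [X in X *: _]fs scale0r linear0.
  move=> B B0; have GB : G [set s | B (rank_one (f s) y)] := u0 B B0.
  have [s Bs] := filter_ex GB.
  by exists (rank_one (f s) y); split=> //; exists (f s) => //; case: (fP s).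
- move=> /(_ (d * `|y|) (mulr_gt0 d0 ny))[_ [n [c [S [c0 c1 AS ->]]]]].
  (* A convex combination of the set is again some [rank_one g y] with [phi g = d]; as the norm
     dominates [phi], its norm is at least [d * |y|]. *)
  have [g gS gd] : exists2 g : dual E, \sum_i c i *: S i = rank_one g y &
      phi g = (\sum_i c i) * d.
    elim/big_rec2 : _ => [|i a T _ [g -> ga]].
      by exists 0; [apply: bop_ext => x; rewrite rank_oneE scale0r|
        rewrite mul0r].
    have [f [f1 fd] <-] := AS i.
    exists (c i *: f + g); first by rewrite rank_oneP.
    by rewrite phiL fd ga mulrDl.
  have gn : opnorm g <= opnorm (0 - rank_one g y) / `|y|.
    apply: opnorm_le => // [|x]; first by rewrite divr_ge0 ?opnorm_ge0.
    rewrite mulrAC ler_pdivlMr//.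
    have := ler_opnorm hK (0 - rank_one g y) x.
    by rewrite bopB bop0 sub0r normrN rank_oneE normrZ.
  rewrite gS -ltr_pdivrMr//; apply/negP.
  rewrite -real_leNgt ?(gtr0_real d0)//; last first.
    by rewrite ger0_real// divr_ge0 ?opnorm_ge0.
  apply: le_trans gn; apply: le_trans (phiB g).
  by rewrite gd c1 mul1r ger0_norm// ltW.
Qed.

End FarFunctional.

(** Points that are good up to [1 / (n + 1)] form a Cauchy sequence, since norming functionals bound
    their distances; the limit represents [phi]. *)
Lemma near_evaluations (K : numFieldType) (hK : real_or_complex K)
    (E : completeNormedModType K) (phi : dual E -> K^o) :
  (forall a f g, phi (a *: f + g) = a * phi f + phi g) ->
  (forall d, 0 < d -> exists m : E, forall f : dual E,
     (forall x, `|f x| <= `|x|) -> `|phi f - f m| <= d) ->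
  exists m : E, forall f, phi f = f m.
Proof.
move=> phiL near_ev.
have /choice[m mP] n : exists m : E, forall f : dual E,
    (forall x, `|f x| <= `|x|) -> `|phi f - f m| <= n.+1%:R^-1.
  by apply: near_ev; rewrite invr_gt0.
have dist_m i j : `|m i - m j| <= i.+1%:R^-1 + j.+1%:R^-1.
  have [f [f1 fm]] := norming_functional hK (m i - m j).
  rewrite -normr_id -fm.
  rewrite (_ : f (m i - m j) = (phi f - f (m j)) - (phi f - f (m i))).
    by rewrite (le_trans (ler_normB _ _))// addrC lerD ?mP.
  by rewrite linearB opprB [RHS]addrC [RHS]addrA subrK.
have /cauchy_cvg/cvg_ex[l ml] : cauchy (m @ \oo).
  apply: cauchy_exP => e e0.
  have [N Ne] := invr_natS_lt hK (divr_gt0 e0 (ltr0Sn _ 1)).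
  exists (m N); exists N => // n /= Nn; rewrite -ball_normE/=.
  by rewrite (le_lt_trans (dist_m _ _))// [ltRHS]splitr ltrD// Ne.
exists l => f.
have [M M0 fM] := bop_bounded f.
have M1 : 0 < M + 1 by rewrite ltr_wpDl.
(* Dividing by [M + 1], positive even if [M] is 0, moves [f] into the unit ball, where the estimates
   hold. *)
pose g := (M + 1)^-1 *: f.
have g1 x : `|g x| <= `|x|.
  rewrite bopZ normrZ normfV gtr0_norm// ler_pdivrMl// (le_trans (fM x))//.
  by rewrite ler_wpM2r// lerDl.
have phi0 : phi 0 = 0.
  by have := phiL (-1) 0 0; rewrite scaler0 addr0 mulN1r addNr.
have phiZ a h : phi (a *: h) = a * phi h.
  by rewrite -[a *: h]addr0 phiL phi0 addr0.
suff pg : phi g = g l.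
  have := congr1 ( *%R (M + 1)) pg.
  by rewrite phiZ bopZ !mulrA divff ?gt_eqF// !mul1r.
have gphi : (fun n => g (m n)) @ \oo --> phi g.
  apply/cvgrPdist_lt => e /(invr_natS_lt hK)[N Ne]; exists N => // n /= Nn.
  by apply: le_lt_trans (Ne _ Nn); exact: mP.
have gl : (fun n => g (m n)) @ \oo --> g l.
  apply/cvgrPdist_lt => e e0; move/cvgrPdist_lt: ml => /(_ _ e0).
  apply: filterS => n; apply: le_lt_trans.
  have gE : g (l - m n) = g l - g (m n) := linearB g l (m n).
  by rewrite -gE.
exact: cvg_unique gphi gl.
Qed.

(** If [l] is not a cluster point of [F], a member of [F] misses a neighbourhood of [l] and with it
    a tail of [u]; what remains is finite. *)
Lemma cvg_range_compact (X : topologicalType) (u : nat -> X) (l : X) :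
  u @ \oo --> l -> compact (range u `|` [set l]).
Proof.
move=> ul F PF FD; have [Fl|/existsNP[A /existsNP[B]]] := pselect (cluster F l).
  by exists l; split=> //; right.
move=> /not_implyP[FA /not_implyP[lB AB]].
have [N _ NB] := ul B lB.
have [||p [[n nN <-] Fp]] := @finite_compact X (u @` `I_N) _ F PF.
- exact: finite_image.
- apply: filterS (filterI FA FD) => x [Ax [[n _ unx]|xl]]; last first.
    by case: AB; exists x; split=> //; rewrite xl; exact: nbhs_singleton.
  exists n => //=; rewrite ltnNge; apply/negP => /NB /= Bun.
  by case: AB; exists x; split=> //; rewrite -unx.
by exists (u n); split=> //; left; exists n.
Qed.

(** The James set is the range of [S n - T], relatively compact as part of a convergent sequence
    with its limit. *)
Lemma james_property_wot_cvg (K : numFieldType) (hK : real_or_complex K)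
    (E F : normedModType K) (S : nat -> bop E F) (T : bop E F) :
  (forall n, image_finite_nets (S n)) -> ~ image_finite_nets T ->
  S @ \oo --> (T : wot E F) -> james_property E F.
Proof.
move=> fS fT ST.
have ST0 : (fun n => S n - T) @ \oo --> (0 : wot E F).
  apply/(@wot_cvgP _ _ _ _ (0 : bop E F)) => x g.
  have STx : (fun n => g (S n x)) @ \oo --> g (T x).
    exact: (@wot_cvgP _ _ _ _ T _).1 ST x g.
  suff uT : (fun n => g ((S n - T) x)) @ \oo --> g ((0 : bop E F) x) by exact: uT.
  have -> : (fun n => g ((S n - T) x)) = (fun n => g (S n x) - g (T x)).
    by apply/funext => n; rewrite bopB; exact: (linearB g).
  have -> : g ((0 : bop E F) x) = g (T x) - g (T x) by rewrite subrr bop0 linear0.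
  by apply: cvgB STx _; exact: cvg_cst.
have cD := @cvg_range_compact (wot E F) (fun n => S n - T) 0 ST0.
exists (range (fun n => S n - T)); split.
- apply: (subclosed_compact _ cD); first exact: closed_closure.
  have clD := compact_closed (wot_hausdorff hK) cD.
  by move=> U AU; apply: clD; apply: closureS AU => V; left.
- move=> B B0; have GB : \forall n \near \oo, B (S n - T) := ST0 B B0.
  by have [n Bn] := filter_ex GB; exists (S n - T); split=> //; exists n.
- move=> T0; apply: fT; apply: image_finite_nets_approx => e /T0.
  move=> [_ [n [c [U [c0 c1 AU ->]]]]] Ue.
  have /choice[k kP] i : exists k, S k - T = U i by case: (AU i) => k; exists k.
  (* As the coefficients sum to 1, this totally bounded operator differs from [T] by the small
     convex combination, up to sign. *)
  exists (\sum_i c i *: S (k i)); first exact: image_finite_nets_sum.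
  move=> x x1; apply: le_lt_trans Ue.
  have -> : T x - (\sum_i c i *: S (k i)) x = (0 - \sum_i c i *: U i) x.
    rewrite bopB bop0 sub0r !bop_sum.
    have -> : T x = \sum_i c i *: T x by rewrite -scaler_suml c1 scale1r.
    rewrite -sumrB -sumrN; apply: eq_bigr => i _.
    by rewrite -kP !bopZ bopB -scalerBr -scalerN opprB.
  by rewrite (le_trans (ler_opnorm hK _ x))// ler_piMr// opnorm_ge0.
Qed.

(** * The approximating sequence *)

Section ApproximatingSequence.
Variables (K : numFieldType) (hK : real_or_complex K).
Variables (E : normedModType K) (F : completeNormedModType K).
Variables (T : bop E F) (eps : K).
Hypothesis T_closure : sot_closure (compact_unit_ball E F) T.
Hypothesis T_noncompact : forall s : seq F,
  exists2 x : E, `|x| <= 1 & forall y, y \in s -> ~ `|T x - y| < eps.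

(** The new list consists of a point whose image is far from those of the old points, the old
    points, and a net for all operators so far, [S] included. *)
Lemma approximating_step (n : nat) (p : seq (bop E F) * seq E) :
  (forall U, U \in p.1 -> image_finite_nets U) ->
  (forall a, a \in p.2 -> `|a| <= 1) ->
  exists (S : bop E F) (A : seq E),
    [/\ image_finite_nets S, forall x, `|S x| <= `|x|,
        forall a, a \in A -> `|a| <= 1 & {subset p.2 <= A}] /\
    [/\ forall a, a \in p.2 -> `|T a - S a| < n.+1%:R^-1,
        exists2 x, x \in A & forall a, a \in p.2 -> ~ `|T x - T a| < eps
      & forall x, `|x| <= 1 -> exists2 a, a \in A &
          forall U, U \in S :: p.1 -> `|U x - U a| < n.+1%:R^-1].
Proof.
case: p => Ts A /= fTs A1.
have n0 : 0 < n.+1%:R^-1 :> K by rewrite invr_gt0.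
have [S [/compact_operatorP fS S1] ST] := sot_closure_approx A T_closure n0.
have [x x1 xA] := T_noncompact (map T A).
have [|s [s1 sP]] := common_net (Ts := S :: Ts) n0.
  by move=> U; rewrite inE => /predU1P[->//|/fTs].
exists S, (x :: A ++ s); split; split=> //.
- exact/opnorm_le1P.
- move=> a; rewrite inE mem_cat => /predU1P[->//|/orP[/A1//|/s1//]].
- by move=> a aA; rewrite inE mem_cat aA orbT.
- by exists x; [rewrite mem_head | move=> a aA; apply: xA; exact: map_f].
- move=> z /sP[a as_ aU]; exists a => //.
  by rewrite inE mem_cat as_ !orbT.
Qed.

Lemma approximating_sequence :
  exists (S : nat -> bop E F) (A : nat -> seq E),
    [/\ forall n, image_finite_nets (S n),
        forall n x, `|S n x| <= `|x|,
        forall n a, a \in A n -> `|a| <= 1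
      & forall m n, (m <= n)%N -> {subset A m <= A n}] /\
    [/\ forall n a, a \in A n -> `|T a - S n a| < n.+1%:R^-1,
        forall n, exists2 x, x \in A n.+1 &
          forall a, a \in A n -> ~ `|T x - T a| < eps
      & forall n x, `|x| <= 1 -> exists2 a, a \in A n.+1 &
          forall k, (k <= n)%N -> `|S k x - S k a| < n.+1%:R^-1].
Proof.
pose ok (p : seq (bop E F) * seq E) :=
  (forall U, U \in p.1 -> image_finite_nets U) /\
  (forall a, a \in p.2 -> `|a| <= 1).
pose next (n : nat) (p : seq (bop E F) * seq E) (q : bop E F * seq E) :=
  [/\ image_finite_nets q.1, forall x, `|q.1 x| <= `|x|,
      forall a, a \in q.2 -> `|a| <= 1 & {subset p.2 <= q.2}] /\
  [/\ forall a, a \in p.2 -> `|T a - q.1 a| < n.+1%:R^-1,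
      exists2 x, x \in q.2 & forall a, a \in p.2 -> ~ `|T x - T a| < eps
    & forall x, `|x| <= 1 -> exists2 a, a \in q.2 &
        forall U, U \in q.1 :: p.1 -> `|U x - U a| < n.+1%:R^-1].
(* Off the invariant [ok] the step takes a junk value, so that [choice] gives a total function. *)
have /choice[step stepP] (np : nat * (seq (bop E F) * seq E)) :
    exists q, ok np.2 -> next np.1 np.2 q.
  have [[fp p1]|] := pselect (ok np.2); last by exists (0, [::]).
  have [S [A SA]] := approximating_step np.1 fp p1.
  by exists (S, A).
(* The state [st n] holds [S (n-1)], ..., [S 0] and [A n], starting from empty lists; step [n] reads
   it and yields [S n] and [A n.+1]. *)
pose st := fix st n := if n is m.+1 then
  let q := step (m, st m) in (q.1 :: (st m).1, q.2) else ([::], [::]).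
have st_ok n : ok (st n).
  elim: n => [|n IH]; first by split.
  have [[fq _ q1 _] _] := stepP (n, st n) IH.
  by split=> //= U; rewrite inE => /predU1P[->//|]; exact: IH.1.
have st_next n : next n (st n) (step (n, st n)).
  exact: stepP (n, st n) (st_ok n).
exists (fun n => (step (n, st n)).1), (fun n => (st n).2); split; split.
- by move=> n; case: (st_next n) => -[].
- by move=> n; case: (st_next n) => -[].
- by move=> n; case: (st_ok n).
- move=> m n; elim: n => [|n IH]; first by rewrite leqn0 => /eqP ->.
  rewrite leq_eqVlt => /predU1P[-> //|]; rewrite ltnS => /IH mn a /mn.
  by case: (st_next n) => -[_ _ _ sub _]; exact: sub.
- by move=> n; case: (st_next n) => _ [].
- by move=> n; case: (st_next n) => _ [].
- move=> n x x1; case: (st_next n) => _ [_ _ /(_ x x1)[a aA aU]].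
  exists a => // k kn; apply: aU.
  have stS j : (st j.+1).1 = (step (j, st j)).1 :: (st j).1 by [].
  suff mem_st j : (k < j)%N -> (step (k, st k)).1 \in (st j).1.
    by have := mem_st n.+1 kn; rewrite stS.
  elim: j => [//|j IH]; rewrite stS inE ltnS leq_eqVlt => /predU1P[->|/IH ->].
    by rewrite eqxx.
  by rewrite orbT.
Qed.

End ApproximatingSequence.

(** * The weak limit *)

Lemma bop_comp_dual (K : numFieldType) (E F : normedModType K) (S : bop E F)
    (g : dual F) : exists f : dual E, forall x, f x = g (S x).
Proof.
have [M M0 gM] := bop_bounded g; have [N N0 SN] := bop_bounded S.
have [|x|f fE] := @bop_exists K E K^o (fun x => g (S x)) (M * N).
- by move=> a x y; rewrite !linearP.
- by rewrite (le_trans (gM _))// -mulrA ler_wpM2l.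
by exists f.
Qed.

(** The limits of the [f (a i)] define a functional on the dual. If it kept more than some [d] away
    from all evaluations, the James property would follow; so it is an evaluation itself. *)
Lemma ultra_limit_represented (K : numFieldType) (hK : real_or_complex K)
    (E : completeNormedModType K) (F : normedModType K) (y : F)
    (I : Type) (U : set_system I) (UU : UltraFilter U) (a : I -> E) :
  y != 0 -> ~ james_property E F -> (forall i, `|a i| <= 1) ->
  exists m : E, forall f : dual E, (fun i => f (a i)) @ U --> f m.
Proof.
move=> y0 nj a1.
have [||phi [phi_lim phiL phiB]] := @ultra_cvg_linear K hK (dual E) I U UU
  (fun i f => f (a i)) (@opnorm K E K^o).
- by move=> i b f g; rewrite bopD bopZ.
- by move=> i f; rewrite (le_trans (ler_opnorm hK f _))// ler_piMr ?opnorm_ge0.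
have [d d0|m mP] := near_evaluations hK phiL; last first.
  by exists m => f; rewrite -mP.
apply: contrapT => nm; apply: nj.
apply: (james_property_far_functional hK phiL phiB y0 d0) => m.
apply: contrapT => nf; apply: nm; exists m => f f1.
rewrite real_leNgt ?normr_real ?gtr0_real//; apply/negP => df.
by apply: nf; exists f.
Qed.

Section WeakLimit.
Variables (K : numFieldType) (hK : real_or_complex K).
Variables (E : completeNormedModType K) (F : normedModType K).
Variables (T : bop E F) (S : nat -> bop E F) (A : nat -> seq E).
Hypothesis T1 : forall x, `|T x| <= `|x|.
Hypothesis S1 : forall n x, `|S n x| <= `|x|.
Hypothesis A1 : forall n a, a \in A n -> `|a| <= 1.
Hypothesis A_mono : forall m n, (m <= n)%N -> {subset A m <= A n}.
Hypothesis TS : forall n a, a \in A n -> `|T a - S n a| < n.+1%:R^-1.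
Hypothesis A_net : forall n x, `|x| <= 1 -> exists2 a, a \in A n.+1 &
  forall k, (k <= n)%N -> `|S k x - S k a| < n.+1%:R^-1.

Let cvg_on_A n a : a \in A n -> (fun k => S k a) @ \oo --> T a.
Proof.
move=> aA; apply/cvgrPdist_lt => e /(invr_natS_lt hK)[N Ne].
exists (maxn N n) => // k /=; rewrite geq_max => /andP[Nk nk].
exact: lt_trans (TS (A_mono nk aA)) (Ne _ Nk).
Qed.

Let dual_cvg (G : set_system nat) (FG : Filter G) (h : nat -> F) (z : F)
    (g : dual F) : h @ G --> z -> (fun k => g (h k)) @ G --> g z.
Proof.
move=> hz; have [M M0 gM] := bop_bounded g.
have M1 : 0 < M + 1 by rewrite ltr_wpDl.
apply/cvgrPdist_lt => e e0.
move/cvgrPdist_lt: hz => /(_ (e / (M + 1)) (divr_gt0 e0 M1)).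
apply: filterS => k; rewrite ltr_pdivlMr// mulrC; apply: le_lt_trans.
have gE : g (z - h k) = g z - g (h k) := linearB g z (h k).
by rewrite -gE (le_trans (gM _))// ler_wpM2r// lerDl.
Qed.

(* A weak limit [m] of points of the [A n] stays in their closed span, where
   [S k] tends to [T]: a limit of [g \o (S k - T)] along an ultrafilter is a
   functional that vanishes on the [A n], hence at [m]. *)
Let weak_cvg_at_limit (U : set_system nat) (UU : UltraFilter U)
    (a : nat -> E) (m : E) :
  (forall n, a n \in A n.+1) ->
  (forall f : dual E, (fun i => f (a i)) @ U --> f m) ->
  forall g : dual F, (fun k => g (S k m)) @ \oo --> g (T m).
Proof.
move=> aA am g; apply: contrapT => ngm.
have [e e0 ne] : exists2 e : K, 0 < e &
    ~ \forall k \near \oo, `|g (T m) - g (S k m)| < e.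
  apply: contrapT => nne; apply: ngm; apply/cvgrPdist_lt => e e0.
  by apply: contrapT => ne; apply: nne; exists e.
(* If convergence fails, the indices with a large error form an infinite set, and some ultrafilter
   containing it refines [\oo]. *)
pose B := [set k | ~ `|g (T m) - g (S k m)| < e].
have PB : ProperFilter (within B \oo).
  apply: Build_ProperFilter => // B0; apply: ne.
  have {}B0 : \forall k \near \oo, B k -> False := B0.
  by apply: filterS B0 => k kB; apply: contrapT => /kB.
have [V [UV BV]] := ultraFilterLemma PB.
have ooV : \oo `<=` V by move=> W ooW; apply: BV; apply: filterS ooW => k.
have VB : V B by apply: BV; exact: (@filterE _ \oo).
have [M M0 gM] := bop_bounded g.
have [||l [hl lL lB]] := @ultra_cvg_linear K hK E nat V UV
  (fun k v => g (S k v) - g (T v)) (fun v => M * `|v| + M * `|v|).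
- by move=> k b u v; rewrite !linearP /= /GRing.scale/=; ring.
- move=> k v; rewrite (le_trans (ler_normB _ _))//.
  by rewrite lerD// (le_trans (gM _))// ler_wpM2l.
have [|f fE] := @bop_exists K E K^o l (M + M) lL.
  by move=> v; rewrite mulrDl.
have fa n : f (a n) = 0.
  rewrite fE; apply: cvg_unique (hl (a n)) _ => //.
  have gS : (fun k => g (S k (a n))) @ \oo --> g (T (a n)).
    by apply: dual_cvg; exact: cvg_on_A (aA n).
  have gSV : (fun k => g (S k (a n))) @ V --> g (T (a n)).
    by move=> W W0; apply: ooV; exact: gS W W0.
  rewrite -(subrr (g (T (a n)))).
  by apply: cvgB gSV _; exact: cvg_cst.
have fm : f m = 0.
  apply: cvg_unique (am f) _ => //.
  by apply: cvg_near_cst; apply: (@filterE _ U); exact: fa.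
have := hl m; rewrite -fE fm => /cvgrPdist_lt/(_ _ e0) Vm.
by have [k [Bk]] := filter_ex (filterI VB Vm); rewrite sub0r opprB.
Qed.

Let weak_limit_ball (y : F) (x : E) : y != 0 -> ~ james_property E F ->
  `|x| <= 1 ->
  exists z : F, forall g : dual F, (fun k => g (S k x)) @ \oo --> g z.
Proof.
move=> y0 nj x1.
have /choice[a aP] n : exists a, a \in A n.+1 /\
    forall k, (k <= n)%N -> `|S k x - S k a| < n.+1%:R^-1.
  by have [a aA aS] := A_net n x1; exists a.
have [U [UU ooU]] := ultraFilterLemma eventually_filter.
have [|m am] := ultra_limit_represented hK UU y0 nj (a := a).
  by move=> n; apply: A1 (aP n).1.
exists (T m) => g.
(* For fixed [k], the [S k (a i)] tend along [U] to [S k x] in norm, since [a i] is close to [x] for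
   [S k] once [i >= k], and weakly to [S k m]. *)
have Sm k : S k m = S k x.
  apply: dual_separates => // h; have [f fE] := bop_comp_dual (S k) h.
  rewrite -fE; apply: cvg_unique (am f) _ => //.
  suff hS : (fun i => h (S k (a i))) @ U --> h (S k x).
    have fhE : (fun i => h (S k (a i))) = (fun i => f (a i)).
      by apply/funext => i; rewrite fE.
    by rewrite fhE in hS; exact: hS.
  apply: dual_cvg; apply/cvgrPdist_lt => e /(invr_natS_lt hK)[N Ne]; apply: ooU.
  exists (maxn N k) => // n /=; rewrite geq_max => /andP[Nn kn].
  exact: lt_trans ((aP n).2 k kn) (Ne n Nn).
have gSm := @weak_cvg_at_limit U UU a m (fun n => (aP n).1) am g.
have SmE : (fun k => g (S k m)) = (fun k => g (S k x)).
  by apply/funext => k; rewrite Sm.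
by rewrite SmE in gSm; exact: gSm.
Qed.

(** The pointwise weak limits are linear by uniqueness of limits and contractive by norming
    functionals; on the [A n] they are norm limits, hence values of [T]. *)
Lemma weak_limit_operator (y : F) : y != 0 -> ~ james_property E F ->
  exists L : bop E F, S @ \oo --> (L : wot E F) /\
    forall n a, a \in A n -> L a = T a.
Proof.
move=> y0 nj.
have /choice[L LP] x : exists z : F,
    forall g : dual F, (fun k => g (S k x)) @ \oo --> g z.
  have [->|x0] := eqVneq x 0.
    exists 0 => g; apply: cvg_near_cst; apply: (@filterE _ \oo) => k.
    by rewrite linear0.
  have nx : `|x| != 0 by rewrite normr_eq0.
  have [|z zP] := weak_limit_ball (x := `|x|^-1 *: x) y0 nj.
    by rewrite normrZ normfV normr_id mulVf.
  exists (`|x| *: z) => g.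
  have -> : (fun k => g (S k x)) = (fun k => `|x| *: g (S k (`|x|^-1 *: x))).
    by apply/funext => k; rewrite linearZ/= linearZ/= scalerA divff// scale1r.
  rewrite linearZ/=; apply: cvgZr; exact: zP.
have L_lin a u v : L (a *: u + v) = a *: L u + L v.
  apply: dual_separates => // g; apply: cvg_unique (LP _ g) _ => //.
  have -> : (fun k => g (S k (a *: u + v))) =
      (fun k => a *: g (S k u) + g (S k v)).
    by apply/funext => k; rewrite !linearP.
  rewrite linearP/=; apply: cvgD (LP v g).
  by apply: cvgZr; exact: LP.
have L1 x : `|L x| <= 1 * `|x|.
  rewrite mul1r; have [g [g1 gL]] := norming_functional hK (L x).
  rewrite -normr_id -gL; apply: cvg_norm_le (LP x g) _ => k.
  exact: le_trans (g1 _) (S1 _ _).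
have [L' L'E] := bop_exists L_lin L1; exists L'; split.
  by apply/(@wot_cvgP _ _ _ _ L') => x g; rewrite L'E; exact: LP.
move=> n a aA; rewrite L'E; apply: dual_separates => // g.
apply: cvg_unique (LP a g) _ => //.
by apply: dual_cvg; exact: cvg_on_A aA.
Qed.

End WeakLimit.

(** * Non-compactness of the weak limit and conclusion *)

Theorem proposition3p6 (K : numFieldType) (hK : real_or_complex K)
    (E F : completeNormedModType K)
    (hEF : sot_closure (compact_unit_ball E F) <> compact_unit_ball E F) :
  james_property E F.
Proof.
have [T TC TnB] : exists2 T, sot_closure (compact_unit_ball E F) T &
    ~ compact_unit_ball E F T.
  apply: contrapT => nT; apply: hEF; apply/seteqP; split=> T TB.
    by apply: contrapT => TnB; apply: nT; exists T.
  exact: (@subset_closure (sot E F)).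
(* Contractivity survives SOT-limits, so what [T] lacks is compactness. *)
have T1 x : `|T x| <= `|x|.
  rewrite real_leNgt ?normr_real//; apply/negP; rewrite -subr_gt0 => e0.
  have [S [_ /(opnorm_le1P hK) S1] /(_ x (mem_head _ _))] :=
    sot_closure_approx [:: x] TC e0.
  apply/negP; rewrite -real_leNgt ?normr_real ?(gtr0_real e0)//.
  by rewrite (le_trans _ (lerB_dist _ _))// lerB.
have Tn : ~ image_finite_nets T.
  by move=> fT; apply: TnB; split; [exact/compact_operatorP | exact/opnorm_le1P].
have [eps [eps0 Teps]] : exists eps : K, 0 < eps /\ forall s : seq F,
    exists2 x : E, `|x| <= 1 & forall y, y \in s -> ~ `|T x - y| < eps.
  apply: contrapT => ne; apply: Tn => e e0; apply: contrapT => ns; apply: ne.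
  exists e; split=> // s; apply: contrapT => nx; apply: ns; exists s.
  move=> _ [x x1 <-]; apply: contrapT => ny; apply: nx; exists x => // y ys xy.
  by apply: ny; exists y.
have [S [A [[fS S1 A1 A_mono] [TS A_sep A_net]]]] :=
  approximating_sequence hK TC Teps.
(* Separation from 0 gives [T x0 != 0], the nonzero vector of [F] that the rank one operators
   need. *)
have [x0 _ /(_ 0 (mem_head _ _))Tx0] := Teps [:: 0].
have y0 : T x0 != 0.
  by apply: contra_notN Tx0 => /eqP ->; rewrite subrr normr0.
(* Failure of the James property provides the weak limit [L], from which the property follows after
   all. *)
apply: contrapT => nj; apply: (nj).
have [L [SL LT]] := weak_limit_operator hK T1 S1 A1 A_mono TS A_net y0 nj.
apply: (james_property_wot_cvg hK fS _ SL) => fL.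
have e20 : 0 < eps / 2 by rewrite divr_gt0.
have [s Ls] := fL _ e20.
(* One stage [N] serves all of the finitely many centres: those within [eps / 2] of the image of
   some [A n] are so for [A N]. *)
have [N NP] : exists N, forall y, y \in s ->
    (exists n, exists2 a, a \in A n & `|T a - y| < eps / 2) ->
    exists2 a, a \in A N & `|T a - y| < eps / 2.
  elim: s {Ls} => [|y s [N NP]]; first by exists 0%N.
  have [[n [a aA ay]]|na] := pselect
      (exists n, exists2 a, a \in A n & `|T a - y| < eps / 2).
    exists (maxn n N) => z; rewrite inE => /predU1P[-> _|zs nz].
      by exists a => //; exact: A_mono (leq_maxl _ _) _ aA.
    have [b bA bz] := NP z zs nz; exists b => //.
    exact: A_mono (leq_maxr _ _) _ bA.
  by exists N => z; rewrite inE => /predU1P[->|]; [move=> /na | exact: NP].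
(* The image of [x] is [eps]-separated from those of [A N], yet it lies within [eps / 2] of a centre
   that is as close to one of them. *)
have [x xA xsep] := A_sep N.
have [|y ys xy] := Ls (L x); first by exists x => //; exact: A1 xA.
rewrite (LT _ _ xA) in xy.
have [|a aA ay] := NP y ys; first by exists N.+1, x.
apply: (xsep a aA); rewrite -(subrK y (T x)) -addrA.
by rewrite (le_lt_trans (ler_normD _ _))// [ltRHS]splitr ltrD// distrC.
Qed.
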